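(* Let $n\geq 1$ and let $S\subseteq \{0,1\}^n$ be a cube-ideal set-system with connectivity $\lambda$, where $\lambda\geq 3$. Then $|S|\geq 2^{(1-H(1/\lambda))n}$.
   Context: A set-system is a subset $S\subseteq\{0,1\}^n$; $\mathrm{conv}(S)$ denotes its convex hull. A capacity inequality is one of $x_i\geq 0$ or $x_i\leq 1$. A generalized set covering (GSC) inequality is an inequality $\sum_{i\in I}x_i+\sum_{j\in J}(1-x_j)\geq 1$ for disjoint $I,J\subseteq[n]$; it uses (involves) $|I|+|J|$ variables. $S$ is cube-ideal if $\mathrm{conv}(S)$ equals the set of points of $\mathbb{R}^n$ satisfying some finite family of capacity and GSC inequalities. The connectivity of $S$ is the minimum number of variables used in a GSC inequality valid for $\mathrm{conv}(S)$, and is $+\infty$ if $S=\{0,1\}^n$. $H:[0,\tfrac12]\to[0,1]$ is the binary entropy function $H(\varepsilon)=-\varepsilon\log_2\varepsilon-(1-\varepsilon)\log_2(1-\varepsilon)$ for $\varepsilon>0$, $H(0)=0$. *)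

(* Defs.v *)
From HB Require Import structures.
From mathcomp Require Import all_boot all_order all_algebra.
From mathcomp Require Import all_classical all_reals all_analysis.

Set Implicit Arguments.
Unset Strict Implicit.
Unset Printing Implicit Defensive.

Import Order.TTheory GRing.Theory Num.Theory.
Local Open Scope classical_set_scope.
Local Open Scope ring_scope.

Notation cube n := {ffun 'I_n -> bool}.

Definition cube_point (R : realType) (n : nat) (s : cube n) : 'rV[R]_n :=
  \row_i (s i)%:R.

Definition conv_hull (R : realType) (n : nat) (S : {set cube n}) :
    set 'rV[R]_n :=
  smallest (@convex_set R 'rV[R]_n) [set cube_point R s | s in [set` S]].

(* IJ = (I, J) stands for \sum_(i in I) x_i + \sum_(j in J) (1 - x_j) >= 1;
   I = J = set0 is allowed and gives the infeasible inequality 0 >= 1, so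
   the empty set-system has connectivity 0. *)
Definition gsc_index (n : nat) := ({set 'I_n} * {set 'I_n})%type.

Definition is_gsc (n : nat) (IJ : gsc_index n) : bool :=
  [disjoint IJ.1 & IJ.2].

Definition gsc_nvars (n : nat) (IJ : gsc_index n) : nat :=
  (#|IJ.1| + #|IJ.2|)%N.

Definition gsc_holds (R : realType) (n : nat) (IJ : gsc_index n)
    (x : 'rV[R]_n) : Prop :=
  1 <= \sum_(i in IJ.1) x 0 i + \sum_(j in IJ.2) (1 - x 0 j).

Definition gsc_valid (R : realType) (n : nat) (S : {set cube n})
    (IJ : gsc_index n) : Prop :=
  forall x : 'rV[R]_n, conv_hull S x -> gsc_holds IJ x.

(* L and U index the inequalities x_i >= 0 and x_i <= 1 of the family. *)
Definition cube_ideal (R : realType) (n : nat) (S : {set cube n}) : Prop :=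
  exists (L U : {set 'I_n}) (G : {set gsc_index n}),
    (forall IJ, IJ \in G -> is_gsc IJ) /\
    conv_hull S =
      [set x : 'rV[R]_n | [/\ forall i, i \in L -> 0 <= x 0 i,
                              forall i, i \in U -> x 0 i <= 1 &
                              forall IJ, IJ \in G -> gsc_holds IJ x]].

(* For S != {0,1}^n the minimum is over a nonempty range (each point of
   {0,1}^n outside S is cut off by a GSC inequality on all n variables), so
   the default value +oo of the big operator plays no role there. *)
Definition connectivity (R : realType) (n : nat) (S : {set cube n}) : \bar R :=
  if S == [set: cube n]%SET then +oo%E
  else \big[Order.min/+oo%E]_(IJ : gsc_index n |
           is_gsc IJ && `[< gsc_valid R S IJ >]) ((gsc_nvars IJ)%:R)%:E.

Definition log2 (R : realType) (x : R) : R := ln x / ln 2.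

(* Only meant for 0 <= e <= 1/2. *)
Definition binary_entropy (R : realType) (e : R) : R :=
  if e == 0 then 0 else - (e * log2 e) - (1 - e) * log2 (1 - e).

(* Main.v *)
Require Import Defs.
From mathcomp Require Import all_boot all_order all_algebra.
From mathcomp Require Import all_classical all_reals all_analysis.
From mathcomp Require Import lra ring.

Set Implicit Arguments.
Unset Strict Implicit.
Unset Printing Implicit Defensive.

Import Order.TTheory GRing.Theory Num.Theory.
Local Open Scope ring_scope.

(** Put [e = 1/lambda].  Every inequality of the description of [conv S]
    involves at least [lambda] variables, so [conv S] contains the shrunk cube
    [e, 1 - e]^n.  For a vertex [y] of the cube, the corresponding vertex of
    the shrunk cube lies at L1-distance [e n] from [y]; since this distance is
    an affine function on the unit cube, some [s \in S] is at Hamming distance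
    at most [e n] from [y].  Hence the Hamming balls of radius [e n] around
    [S] cover the cube, and each has at most [2 ^ (H(e) n)] elements. *)

Definition hamming (n : nat) (y s : cube n) : nat := #|[set i | y i != s i]|.

(** Written without absolute values, so that it is affine in [x] on the whole space; it is the
    L1-distance to [y] only for [x] in the unit cube. *)
Definition l1_dist (R : realType) (n : nat) (y : cube n) (x : 'rV[R]_n) : R :=
  \sum_i (if y i then 1 - x 0 i else x 0 i).

Definition shrunk_vertex (R : realType) (n : nat) (e : R) (y : cube n) :
    'rV[R]_n :=
  \row_i (if y i then 1 - e else e).

Lemma l1_dist_cube_point (R : realType) (n : nat) (y s : cube n) :
  l1_dist y (cube_point R s) = (hamming y s)%:R.
Proof.
rewrite /hamming -sum1_card natr_sum big_mkcond; apply: eq_bigr => i _.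
by rewrite mxE inE; case: (y i) (s i) => [] [] /=; rewrite ?subrr ?subr0.
Qed.

Lemma l1_dist_shrunk_vertex (R : realType) (n : nat) (e : R) (y : cube n) :
  l1_dist y (shrunk_vertex e y) = e * n%:R.
Proof.
rewrite /l1_dist (eq_bigr (fun=> e)) => [|i _]; last first.
  by rewrite mxE; case: (y i); lra.
by rewrite sumr_const card_ord mulr_natr.
Qed.

Lemma l1_dist_conv (R : realType) (n : nat) (y : cube n) (x z : 'rV[R]_n)
    (t : R) :
  l1_dist y (t *: x + (1 - t) *: z) = t * l1_dist y x + (1 - t) * l1_dist y z.
Proof.
rewrite /l1_dist !mulr_sumr -big_split /=; apply: eq_bigr => i _.
by rewrite !mxE; case: (y i); ring.
Qed.

(** Otherwise the open half-space of points [z] with [l1_dist y x < l1_dist y z] would contain [S],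
    hence its convex hull, hence [x] itself. *)
Lemma conv_hull_l1_dist (R : realType) (n : nat) (S : {set cube n})
    (y : cube n) (x : 'rV[R]_n) :
  conv_hull S x -> exists2 s, s \in S & (hamming y s)%:R <= l1_dist y x.
Proof.
move=> Sx; apply: contrapT => farS.
suff: l1_dist y x < l1_dist y x by rewrite ltxx.
apply: (Sx [set z | l1_dist y x < l1_dist y z]%classic); split.
  apply/convex_setW => u v; rewrite !inE /= => yu yv t t0 t1.
  rewrite inE; change (l1_dist y x <
    l1_dist y (t%:num *: u + (1 - t%:num) *: v)).
  rewrite l1_dist_conv; nra.
move=> _ [s /= sS <-]; rewrite l1_dist_cube_point ltNge.
by apply/negP => le_ys; apply: farS; exists s.
Qed.

(** All coordinates lie in [[e, 1 - e]], so each term [x_i] or [1 - x_j] of a GSC inequality is at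
    least [e], and the left-hand side is at least [e] times the number of variables. *)
Lemma cube_ideal_shrunk_vertex (R : realType) (n : nat) (S : {set cube n})
    (e : R) (y : cube n) :
  cube_ideal R S -> 0 <= e <= 1 / 2 ->
  (forall IJ, is_gsc IJ -> gsc_valid R S IJ -> 1 <= e * (gsc_nvars IJ)%:R) ->
  conv_hull S (shrunk_vertex e y).
Proof.
move=> [L [U [G [gscG defS]]]] e_bnd gsc_large.
have vP i : e <= shrunk_vertex e y 0 i <= 1 - e.
  by rewrite mxE; case: (y i); lra.
rewrite defS; split=> [i _|i _|IJ IJG]; [have := vP i; lra..|].
have validIJ : gsc_valid R S IJ by move=> x; rewrite defS => -[_ _]; apply.
apply: le_trans (gsc_large _ (gscG _ IJG) validIJ) _.
rewrite /gsc_nvars natrD mulrDr !mulr_natr -!sumr_const.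
by apply: lerD; apply: ler_sum => i _; have := vP i; lra.
Qed.

(** The summand is the probability of reaching [y] from [s] by flipping each coordinate
    independently with probability [e]; the sum is the expansion of a product of factors
    [e + (1 - e)]. *)
Lemma cube_binomial_weight (R : realType) (n : nat) (e : R) (s : cube n) :
  \sum_(y : cube n) e ^+ hamming y s * (1 - e) ^+ (n - hamming y s) = 1.
Proof.
transitivity (\sum_(y : cube n) \prod_i (if y i != s i then e else 1 - e)).
  apply: eq_bigr => y _; rewrite (bigID (fun i => y i != s i)) /=.
  congr (_ * _).
    rewrite (eq_bigr (fun=> e)) => [|i ->//]; rewrite prodr_const.
    by congr (_ ^+ _); apply: eq_card => i; rewrite !inE.
  rewrite (eq_bigr (fun=> 1 - e)) => [|i /negPf->//]; rewrite prodr_const.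
  congr (_ ^+ _); rewrite /hamming -[X in (X - _)%N]card_ord.
  rewrite -(cardsC [set i | y i != s i]) addKn.
  by apply: eq_card => i; rewrite !inE.
rewrite -(bigA_distr_bigA (fun i b => if b != s i then e else 1 - e)).
by rewrite big1 // => i _; rewrite big_bool /=; case: (s i) => /=; lra.
Qed.

(** As [e <= 1 - e], the weight decreases in [d], and at [d = e * n] it would equal the left-hand
    side. *)
Lemma entropy_weight (R : realType) (n d : nat) (e : R) :
  0 <= e <= 1 / 2 -> (d <= n)%N -> d%:R <= e * n%:R ->
  2 `^ (- (binary_entropy e * n%:R)) <= e ^+ d * (1 - e) ^+ (n - d).
Proof.
move=> e_bnd d_n d_en; have ln2_gt0 : 0 < ln (2 : R) by rewrite ln_gt0 ?ltr1n.
have [e0|e_neq0] := eqVneq e 0.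
  have -> : d = 0%N by apply/eqP; move: d_en; rewrite e0 mul0r lern0.
  rewrite /binary_entropy e0 eqxx mul0r oppr0 powRr0.
  by rewrite expr0 addr0 expr1n mulr1.
have e_gt0 : 0 < e by rewrite lt_neqAle eq_sym e_neq0; lra.
have e1_gt0 : 0 < 1 - e by lra.
rewrite /powR pnatr_eq0 /= -[X in X ^+ d](@lnK _ e) ?posrE //.
rewrite -[X in X ^+ (n - d)](@lnK _ (1 - e)) ?posrE //.
rewrite -!expRM_natl -expRD ler_expR.
rewrite /binary_entropy (negPf e_neq0) /log2 natrB //.
have ln_le : ln e <= ln (1 - e) by rewrite ler_ln ?posrE //; lra.
have -> : - ((- (e * (ln e / ln 2)) - (1 - e) * (ln (1 - e) / ln 2))
    * n%:R) * ln 2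
  = (e * ln e + (1 - e) * ln (1 - e)) * n%:R by field; lra.
(* The difference of the two exponents is [(e * n - d) * (ln (1 - e) - ln e)]. *)
nra.
Qed.

(** Double counting replaces a bound on ball sizes: each [s] in [S] spreads total weight 1 over the
    cube, and each of the [2 ^ n] vertices receives at least [2 ^ (- H(e) n)] from a nearby [s]. *)
Lemma hamming_cover_card (R : realType) (n : nat) (S : {set cube n}) (e : R) :
  0 <= e <= 1 / 2 ->
  (forall y, exists2 s, s \in S & (hamming y s)%:R <= e * n%:R) ->
  2 `^ ((1 - binary_entropy e) * n%:R) <= #|S|%:R :> R.
Proof.
move=> e_bnd coverS.
rewrite mulrBl mul1r powRD ?pnatr_eq0 ?implybT // powR_mulrn //.
pose w (y s : cube n) := e ^+ hamming y s * (1 - e) ^+ (n - hamming y s).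
have w_ge0 y s : 0 <= w y s by rewrite mulr_ge0 // exprn_ge0 //; lra.
have -> : #|S|%:R = \sum_(y : cube n) \sum_(s in S) w y s.
  rewrite exchange_big /= (eq_bigr (fun=> 1)) => [|s _].
    by rewrite sumr_const.
  exact: cube_binomial_weight.
have -> : 2 ^+ n = #|{: cube n}|%:R :> R.
  by rewrite card_ffun card_bool card_ord natrX.
rewrite mulr_natl -sumr_const; apply: ler_sum => y _.
have [s sS ys] := coverS y.
rewrite (bigD1 s) //= -[leLHS]addr0 lerD ?sumr_ge0 //.
by apply: entropy_weight => //; rewrite -[leqRHS]card_ord max_card.
Qed.

Lemma connectivity_le_nvars (R : realType) (n : nat) (S : {set cube n})
    (IJ : gsc_index n) :
  S != [set: cube n]%SET -> is_gsc IJ -> gsc_valid R S IJ ->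
  (connectivity R S <= (gsc_nvars IJ)%:R%:E)%E.
Proof.
move=> /negPf SnT gscIJ validIJ; rewrite /connectivity SnT.
by apply: bigmin_le_cond; rewrite gscIJ; apply/asboolP.
Qed.

Theorem theorem1p1 (R : realType) (n : nat) (S : {set cube n})
    (lambda : \bar R)
    (n_ge1 : (1 <= n)%N)
    (S_ideal : cube_ideal R S)
    (S_conn : connectivity R S = lambda)
    (lambda_ge3 : (3%:E <= lambda)%E) :
  2 `^ ((1 - binary_entropy (fine (1 / lambda)%E)) * n%:R) <= #|S|%:R :> R.
Proof.
(* For [lambda = +oo] the inverse is 0, which gives [e = 0]. *)
have e_bnd : 0 <= fine (1 / lambda)%E <= 1 / 2.
  rewrite div1e; case: lambda {S_conn} lambda_ge3 => [r| |] //=; last lra.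
  rewrite lee_fin fine_invr => r3.
  by rewrite invr_ge0 ler_pdivlMr // ler_pdivrMl; lra.
apply: hamming_cover_card => // y.
(* On the full cube the connectivity is [+oo] by convention rather than a minimum; there [y] covers
   itself. *)
have [->|SnT] := eqVneq S [set: cube n]%SET.
  exists y; first by rewrite inE.
  have -> : hamming y y = 0%N.
    by apply/eqP; rewrite cards_eq0; apply/eqP/setP => i; rewrite !inE eqxx.
  by rewrite mulr_ge0 //; lra.
rewrite -(@l1_dist_shrunk_vertex _ _ _ y); apply: conv_hull_l1_dist.
apply: cube_ideal_shrunk_vertex => // IJ gscIJ validIJ.
have := @connectivity_le_nvars R n S IJ SnT gscIJ validIJ.
(* Here [lambda] is finite, being bounded by the number of variables of [IJ]. *)
rewrite S_conn div1e; case: lambda {S_conn e_bnd} lambda_ge3 => [r| |] //=.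
rewrite !lee_fin fine_invr => r3 r_le.
by rewrite ler_pdivlMl ?mulr1 //; lra.
Qed.
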